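(* Let $\mathcal{C}$ be a triangulated category and $\xi$ a proper class of triangles in $\mathcal{C}$ such that $\mathcal{C}$ has enough $\xi$-projectives. Let $A\in\mathcal{C}$ and let $n$ be a non-negative integer. Then the following statements are equivalent: (1) $\xi\text{-}\mathrm{Gpd}(A)\leq n$. (2) For every $0\leq i\leq n$ there is a $\xi$-exact sequence $$0\to P_{n}\to\cdots\to P_{i+1}\to G\to P_{i-1}\to\cdots\to P_{0}\to A\to 0$$ with $P_{j}\in\mathcal{P}(\xi)$ for all $0\leq j\leq n$, $j\neq i$, and $G\in\mathcal{GP}(\xi)$. (3) For every $0\leq i\leq n$ there is a $\xi$-exact sequence $$0\to G_{n}\to\cdots\to G_{i+1}\to P\to G_{i-1}\to\cdots\to G_{0}\to A\to 0$$ with $G_{j}\in\mathcal{GP}(\xi)$ for all $0\leq j\leq n$, $j\neq i$, and $P\in\mathcal{P}(\xi)$.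
   Context: Let $\mathcal{C}=(\mathcal{C},\Sigma,\Delta)$ be a triangulated category with suspension $\Sigma$ and class of distinguished triangles $\Delta$. **Base change.** For a triangle $A\xrightarrow{f}B\xrightarrow{g}C\xrightarrow{h}\Sigma A$ in $\Delta$ and a morphism $\varepsilon:E\to C$, the octahedral axiom gives a base change diagram: triangles $A\xrightarrow{f'}G\xrightarrow{g'}E\xrightarrow{h'}\Sigma A$, $M\to G\xrightarrow{\beta}B\to\Sigma M$ and $M\to E\xrightarrow{\varepsilon}C\to\Sigma M$ in $\Delta$, such that $(1_A,\beta,\varepsilon)$ is a morphism of triangles from $A\to G\to E\to\Sigma A$ to $A\to B\to C\to\Sigma A$ (so $h'=h\varepsilon$) and $(1_M,g',g)$ is a morphism of triangles from $M\to G\to B\to\Sigma M$ to $M\to E\to C\to\Sigma M$. **Cobase change.** Dually, for a triangle $A\xrightarrow{f}B\xrightarrow{g}C\xrightarrow{h}\Sigma A$ and a morphism $\alpha:A\to D$, there is a triangle $D\xrightarrow{f'}F\xrightarrow{g'}C\xrightarrow{h'}\Sigma D$ with $h'=(\Sigma\alpha)h$, fitting into the dual diagram. **Proper class.** A class $\xi\subseteq\Delta$ is a proper class of triangles if: (1) $\xi$ is closed under isomorphisms and finite coproducts and contains all split triangles; (2) $\xi$ is closed under suspensions (if $A\xrightarrow{f}B\xrightarrow{g}C\xrightarrow{h}\Sigma A$ is in $\xi$ and $i\in\mathbb{Z}$, then $\Sigma^iA\xrightarrow{(-1)^i\Sigma^if}\Sigma^iB\xrightarrow{(-1)^i\Sigma^ig}\Sigma^iC\xrightarrow{(-1)^i\Sigma^ih}\Sigma^{i+1}A$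 is in $\xi$), and saturated (in every base change diagram, if $M\to E\to C\to\Sigma M$ and $A\to G\to E\to\Sigma A$ are in $\xi$, then $A\to B\to C\to\Sigma A$ is in $\xi$); (3) $\xi$ is closed under base change ($A\to B\to C\to\Sigma A$ in $\xi$ implies $A\to G\to E\to\Sigma A$ in $\xi$) and under cobase change ($A\to B\to C\to\Sigma A$ in $\xi$ implies $D\to F\to C\to\Sigma D$ in $\xi$). **$\xi$-projectives.** An object $P$ is $\xi$-projective if for every triangle $A\to B\to C\to\Sigma A$ in $\xi$ the sequence $0\to\mathrm{Hom}_{\mathcal{C}}(P,A)\to\mathrm{Hom}_{\mathcal{C}}(P,B)\to\mathrm{Hom}_{\mathcal{C}}(P,C)\to0$ is exact; $\mathcal{P}(\xi)$ is the full subcategory of $\xi$-projective objects. $\mathcal{C}$ has enough $\xi$-projectives if for every object $A$ there is a triangle $K\to P\to A\to\Sigma K$ in $\xi$ with $P\in\mathcal{P}(\xi)$. **$\xi$-Gorenstein projectives.** A triangle $A\to B\to C\to\Sigma A$ in $\xi$ is $\mathrm{Hom}_{\mathcal{C}}(-,\mathcal{P}(\xi))$-exact if $0\to\mathrm{Hom}_{\mathcal{C}}(C,Q)\to\mathrm{Hom}_{\mathcal{C}}(B,Q)\to\mathrm{Hom}_{\mathcal{C}}(A,Q)\to0$ is exact for every $Q\in\mathcal{P}(\xi)$. An object $A$ is $\xi$-Gorenstein projective if there exist, for all $m\in\mathbb{Z}$, $\mathrm{Hom}_{\mathcal{C}}(-,\mathcal{P}(\xi))$-exact triangles $K_{m+1}\to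 P_m\to K_m\to\Sigma K_{m+1}$ in $\xi$ with $P_m\in\mathcal{P}(\xi)$ and $K_0=A$. $\mathcal{GP}(\xi)$ is the full subcategory of such objects. **$\xi$-exact sequences.** A $\xi$-exact sequence $0\to X_n\to\cdots\to X_0\to A\to0$ is a diagram for which there are triangles $K_{j+1}\xrightarrow{f_j}X_j\xrightarrow{g_j}K_j\to\Sigma K_{j+1}$ in $\xi$ for $0\le j\le n$, with $K_0=A$ and $K_{n+1}=0$, such that the map $X_j\to X_{j-1}$ is $f_{j-1}g_j$ for $1\le j\le n$ and $X_0\to A$ is $g_0$. **Dimension.** $\xi\text{-}\mathrm{Gpd}(A)\le n$ means that there is a $\xi$-exact sequence $0\to G_n\to\cdots\to G_1\to G_0\to A\to0$ with $G_i\in\mathcal{GP}(\xi)$ for all $0\le i\le n$.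
   Formalization: The implication (1) ⇒ (3) is stated only for n ≥ 1, since for n = 0 it would force every ξ-Gorenstein projective A to be ξ-projective, which fails for ξ = Δ; (1) ⇔ (2) and (3) ⇒ (1) are stated for all n ≥ 0. *)

(* Defs.v *)
From HB Require Import structures.
From mathcomp Require Import all_boot all_order all_algebra.

Set Implicit Arguments.
Unset Strict Implicit.
Unset Printing Implicit Defensive.

Import GRing.Theory.
Local Open Scope ring_scope.

Record additive_category := AdditiveCategory {
  obj :> Type;
  mor : obj -> obj -> zmodType;
  idm : forall A, mor A A;
  compose : forall A B C, mor B C -> mor A B -> mor A C;
  composeA : forall A B C D (h : mor C D) (g : mor B C) (f : mor A B),
    compose h (compose g f) = compose (compose h g) f;
  compose1m : forall A B (f : mor A B), compose (idm B) f = f;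
  composem1 : forall A B (f : mor A B), compose f (idm A) = f;
  composeDl : forall A B C (g g' : mor B C) (f : mor A B),
    compose (g + g') f = compose g f + compose g' f;
  composeDr : forall A B C (g : mor B C) (f f' : mor A B),
    compose g (f + f') = compose g f + compose g f';
  zero_obj : obj;
  zero_objP : idm zero_obj = 0;
  biprod : obj -> obj -> obj;
  in1 : forall A B, mor A (biprod A B);
  in2 : forall A B, mor B (biprod A B);
  pr1 : forall A B, mor (biprod A B) A;
  pr2 : forall A B, mor (biprod A B) B;
  pr1_in1 : forall A B, compose (pr1 A B) (in1 A B) = idm A;
  pr2_in2 : forall A B, compose (pr2 A B) (in2 A B) = idm B;
  pr1_in2 : forall A B, compose (pr1 A B) (in2 A B) = 0;
  pr2_in1 : forall A B, compose (pr2 A B) (in1 A B) = 0;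
  biprodP : forall A B,
    compose (in1 A B) (pr1 A B) + compose (in2 A B) (pr2 A B) = idm (biprod A B)
}.

Arguments mor {_} _ _.
Arguments idm {_} _.
Arguments compose {_ _ _ _} _ _.
Arguments in1 {_} _ _.
Arguments in2 {_} _ _.
Arguments pr1 {_} _ _.
Arguments pr2 {_} _ _.
Arguments zero_obj {_}.

Notation "g ∘ f" := (compose g f) (at level 40, left associativity).

Definition is_zero (C : additive_category) (Z : C) : Prop := idm Z = 0.

Definition is_iso (C : additive_category) (A B : C) (f : mor A B) : Prop :=
  exists g : mor B A, g ∘ f = idm A /\ f ∘ g = idm B.

(* The suspension is an additive autoequivalence, not necessarily an
   automorphism: [desusp] is a chosen quasi-inverse.  The triangle identity
   [adj_counit_unit] (which any equivalence satisfies after adjusting the unit)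
   makes [adj_unit] and [adj_counit] compatible, so that signs in desuspended
   triangles are the right ones. *)
Record suspended_category := SuspendedCategory {
  add_base :> additive_category;
  susp : add_base -> add_base;
  suspm : forall A B : add_base, mor A B -> mor (susp A) (susp B);
  suspm1 : forall A : add_base, suspm (idm A) = idm (susp A);
  suspm_comp : forall (A B C : add_base) (g : mor B C) (f : mor A B),
    suspm (g ∘ f) = suspm g ∘ suspm f;
  suspmD : forall (A B : add_base) (f g : mor A B),
    suspm (f + g) = suspm f + suspm g;
  desusp : add_base -> add_base;
  desuspm : forall A B : add_base, mor A B -> mor (desusp A) (desusp B);
  desuspm1 : forall A : add_base, desuspm (idm A) = idm (desusp A);
  desuspm_comp : forall (A B C : add_base) (g : mor B C) (f : mor A B),
    desuspm (g ∘ f) = desuspm g ∘ desuspm f;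
  adj_unit : forall A : add_base, mor A (desusp (susp A));
  adj_unitV : forall A : add_base, mor (desusp (susp A)) A;
  adj_unitK : forall A, adj_unitV A ∘ adj_unit A = idm A;
  adj_unitVK : forall A, adj_unit A ∘ adj_unitV A = idm (desusp (susp A));
  adj_unit_nat : forall (A B : add_base) (f : mor A B),
    adj_unit B ∘ f = desuspm (suspm f) ∘ adj_unit A;
  adj_counit : forall A : add_base, mor (susp (desusp A)) A;
  adj_counitV : forall A : add_base, mor A (susp (desusp A));
  adj_counitK : forall A, adj_counitV A ∘ adj_counit A = idm (susp (desusp A));
  adj_counitVK : forall A, adj_counit A ∘ adj_counitV A = idm A;
  adj_counit_nat : forall (A B : add_base) (f : mor A B),
    f ∘ adj_counit A = adj_counit B ∘ suspm (desuspm f);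
  adj_counit_unit : forall A,
    adj_counit (susp A) ∘ suspm (adj_unit A) = idm (susp A)
}.

Arguments susp {_} _.
Arguments suspm {_ _ _} _.
Arguments desusp {_} _.
Arguments desuspm {_ _ _} _.
Arguments adj_unit {_} _.
Arguments adj_unitV {_} _.
Arguments adj_counit {_} _.
Arguments adj_counitV {_} _.

(* A candidate triangle A -> B -> C -> susp A, not assumed distinguished. *)
Record triangle (T : suspended_category) := Triangle {
  vA : T; vB : T; vC : T;
  mf : mor vA vB; mg : mor vB vC; mh : mor vC (susp vA)
}.

Arguments Triangle {_ _ _ _} _ _ _.

Section Triangles.
Variable T : suspended_category.
Implicit Types t u : triangle T.

Definition is_triangle_morphism t u (a : mor (vA t) (vA u))
    (b : mor (vB t) (vB u)) (c : mor (vC t) (vC u)) : Prop :=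
  [/\ b ∘ mf t = mf u ∘ a, c ∘ mg t = mg u ∘ b & suspm a ∘ mh t = mh u ∘ c].

Definition triangle_iso t u : Prop :=
  exists (a : mor (vA t) (vA u)) (b : mor (vB t) (vB u))
         (c : mor (vC t) (vC u)),
    [/\ is_iso a, is_iso b, is_iso c & is_triangle_morphism a b c].

Definition rotate t : triangle T :=
  Triangle (mg t) (mh t) (- suspm (mf t)).

Definition shift_up t : triangle T :=
  Triangle (- suspm (mf t)) (- suspm (mg t)) (- suspm (mh t)).

Definition shift_down t : triangle T :=
  Triangle (- desuspm (mf t)) (- desuspm (mg t))
    (- (adj_counitV (vA t) ∘ (adj_unitV (vA t) ∘ desuspm (mh t)))).

(* The i-fold suspension of a triangle; each step contributes a sign, hence
   the three maps carry the sign (-1)^i. *)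
Definition shiftz (i : int) t : triangle T :=
  match i with
  | Posz n => iter n shift_up t
  | Negz n => iter n.+1 shift_down t
  end.

Definition biprodm (A B A' B' : T) (f : mor A B) (f' : mor A' B') :
    mor (biprod A A') (biprod B B') :=
  in1 B B' ∘ f ∘ pr1 A A' + in2 B B' ∘ f' ∘ pr2 A A'.

(* The last map involves the canonical map
   susp A (+) susp A' -> susp (A (+) A'). *)
Definition triangle_sum t u : triangle T :=
  Triangle (biprodm (mf t) (mf u)) (biprodm (mg t) (mg u))
    (suspm (in1 (vA t) (vA u)) ∘ mh t ∘ pr1 (vC t) (vC u)
     + suspm (in2 (vA t) (vA u)) ∘ mh u ∘ pr2 (vC t) (vC u)).

Definition is_split t : Prop :=
  exists A C : T,
    triangle_iso (Triangle (in1 A C) (pr2 A C) (0 : mor C (susp A))) t.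

End Triangles.

Record triangulated_category := TriangulatedCategory {
  susp_base :> suspended_category;
  dist : triangle susp_base -> Prop;
  dist_iso : forall t u, triangle_iso t u -> dist t -> dist u;
  dist_id : forall A : susp_base,
    dist (Triangle (idm A) (0 : mor A zero_obj) (0 : mor zero_obj (susp A)));
  dist_cone : forall (A B : susp_base) (f : mor A B),
    exists (C : susp_base) (g : mor B C) (h : mor C (susp A)),
      dist (Triangle f g h);
  dist_rotate : forall t, dist t <-> dist (rotate t);
  dist_fill : forall t u (a : mor (vA t) (vA u)) (b : mor (vB t) (vB u)),
    dist t -> dist u -> b ∘ mf t = mf u ∘ a ->
    exists c : mor (vC t) (vC u), is_triangle_morphism a b c;
  dist_octahedral : forall (A B C X Y Z : susp_base)
      (f : mor A B) (i : mor B Z) (j : mor Z (susp A))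
      (g : mor B C) (k : mor C X) (l : mor X (susp B))
      (m : mor C Y) (n : mor Y (susp A)),
    dist (Triangle f i j) -> dist (Triangle g k l) ->
    dist (Triangle (g ∘ f) m n) ->
    exists (u : mor Z Y) (v : mor Y X),
      [/\ dist (Triangle u v (suspm i ∘ l)),
          u ∘ i = m ∘ g /\ n ∘ u = j &
          v ∘ m = k /\ l ∘ v = suspm f ∘ n]
}.

Arguments dist {_} _.

Section ProperClasses.
Variable T : triangulated_category.

Definition triangle_class := triangle T -> Prop.

Definition is_base_change (A B C E G M : T)
    (f : mor A B) (g : mor B C) (h : mor C (susp A)) (e : mor E C)
    (f' : mor A G) (g' : mor G E) (h' : mor E (susp A))
    (d : mor M E) (z : mor C (susp M))
    (d' : mor M G) (b : mor G B) (z' : mor B (susp M)) : Prop :=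
  [/\ dist (Triangle f g h) /\ dist (Triangle f' g' h'),
      dist (Triangle d e z) /\ dist (Triangle d' b z'),
      is_triangle_morphism (t := Triangle f' g' h') (u := Triangle f g h)
        (idm A) b e &
      is_triangle_morphism (t := Triangle d' b z') (u := Triangle d e z)
        (idm M) g' g].

Definition is_cobase_change (A B C D F N : T)
    (f : mor A B) (g : mor B C) (h : mor C (susp A)) (a : mor A D)
    (f' : mor D F) (g' : mor F C) (h' : mor C (susp D))
    (d : mor D N) (z : mor N (susp A))
    (b : mor B F) (d' : mor F N) (z' : mor N (susp B)) : Prop :=
  [/\ dist (Triangle f g h) /\ dist (Triangle f' g' h'),
      dist (Triangle a d z) /\ dist (Triangle b d' z'),
      is_triangle_morphism (t := Triangle f g h) (u := Triangle f' g' h')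
        a b (idm C) &
      is_triangle_morphism (t := Triangle a d z) (u := Triangle b d' z')
        f f' (idm N)].

(* Finite coproducts: binary ones suffice, the empty coproduct being a split
   triangle. *)
Record proper_class (xi : triangle_class) : Prop := ProperClass {
  proper_dist : forall t, xi t -> dist t;
  proper_iso : forall t u, triangle_iso t u -> xi t -> xi u;
  proper_sum : forall t u, xi t -> xi u -> xi (triangle_sum t u);
  proper_split : forall t, is_split t -> xi t;
  proper_shift : forall (i : int) t, xi t -> xi (shiftz i t);
  proper_saturated : forall (A B C E G M : T)
      (f : mor A B) (g : mor B C) (h : mor C (susp A)) (e : mor E C)
      (f' : mor A G) (g' : mor G E) (h' : mor E (susp A))
      (d : mor M E) (z : mor C (susp M))
      (d' : mor M G) (b : mor G B) (z' : mor B (susp M)),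
    is_base_change f g h e f' g' h' d z d' b z' ->
    xi (Triangle d e z) -> xi (Triangle f' g' h') -> xi (Triangle f g h);
  proper_base_change : forall (A B C E G M : T)
      (f : mor A B) (g : mor B C) (h : mor C (susp A)) (e : mor E C)
      (f' : mor A G) (g' : mor G E) (h' : mor E (susp A))
      (d : mor M E) (z : mor C (susp M))
      (d' : mor M G) (b : mor G B) (z' : mor B (susp M)),
    is_base_change f g h e f' g' h' d z d' b z' ->
    xi (Triangle f g h) -> xi (Triangle f' g' h');
  proper_cobase_change : forall (A B C D F N : T)
      (f : mor A B) (g : mor B C) (h : mor C (susp A)) (a : mor A D)
      (f' : mor D F) (g' : mor F C) (h' : mor C (susp D))
      (d : mor D N) (z : mor N (susp A))
      (b : mor B F) (d' : mor F N) (z' : mor N (susp B)),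
    is_cobase_change f g h a f' g' h' d z b d' z' ->
    xi (Triangle f g h) -> xi (Triangle f' g' h')
}.

(* Exactness of 0 -> U -> V -> W -> 0, for additive maps f and g. *)
Definition short_exact (U V W : zmodType) (f : U -> V) (g : V -> W) : Prop :=
  [/\ injective f,
      forall v, g v = 0 <-> exists u, f u = v &
      forall w, exists v, g v = w].

Variable xi : triangle_class.

Definition xi_projective (P : T) : Prop :=
  forall t, xi t ->
    short_exact (fun a : mor P (vA t) => mf t ∘ a)
                (fun b : mor P (vB t) => mg t ∘ b).

Definition enough_projectives : Prop :=
  forall A : T, exists (K P : T) (f : mor K P) (g : mor P A)
      (h : mor A (susp K)),
    xi_projective P /\ xi (Triangle f g h).

Definition hom_proj_exact (t : triangle T) : Prop :=
  forall Q : T, xi_projective Q ->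
    short_exact (fun c : mor (vC t) Q => c ∘ mg t)
                (fun b : mor (vB t) Q => b ∘ mf t).

Definition gorenstein_projective (A : T) : Prop :=
  exists (K P : int -> T)
      (f : forall m, mor (K (m + 1)) (P m)) (g : forall m, mor (P m) (K m))
      (h : forall m, mor (K m) (susp (K (m + 1)))),
    (forall m, [/\ xi_projective (P m),
                   xi (Triangle (f m) (g m) (h m)) &
                   hom_proj_exact (Triangle (f m) (g m) (h m))])
    /\ K 0 = A.

(* A diagram ... -> X_1 -> X_0 -> A; in a sequence 0 -> X_n -> ... -> A -> 0
   only the terms of index at most n and the maps between them matter. *)
Record augmented_seq (A : T) := AugmentedSeq {
  seq_obj : nat -> T;
  seq_diff : forall j, mor (seq_obj j.+1) (seq_obj j);
  seq_aug : mor (seq_obj 0) A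
}.

(* K_0 = A and K_(j+1) = K j, so that no transport along K_0 = A is needed. *)
Definition syzygy (A : T) (K : nat -> T) (j : nat) : T :=
  if j is j'.+1 then K j' else A.

Definition xi_exact (n : nat) (A : T) (X : augmented_seq A) : Prop :=
  exists (K : nat -> T)
      (f : forall j, mor (syzygy A K j.+1) (seq_obj X j))
      (g : forall j, mor (seq_obj X j) (syzygy A K j))
      (h : forall j, mor (syzygy A K j) (susp (syzygy A K j.+1))),
    [/\ forall j, (j <= n)%N -> xi (Triangle (f j) (g j) (h j)),
        is_zero (syzygy A K n.+1),
        forall j, (j < n)%N -> seq_diff X j = f j ∘ g j.+1 &
        seq_aug X = g 0%N].

Definition gpd_le (A : T) (n : nat) : Prop :=
  exists X : augmented_seq A,
    xi_exact n X /\ forall j, (j <= n)%N -> gorenstein_projective (seq_obj X j).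

End ProperClasses.

(* Main.v *)
(** Call a morphism ghost if it is killed by precomposition with every map out
    of a [xi]-projective.  Saturation and enough projectives give that a
    distinguished triangle lies in [xi] iff its last map is ghost, so membership
    in [xi] of the triangles produced by the octahedral axiom reduces to
    composing ghosts.

    Ghosts from a Gorenstein projective object to a projective one vanish, hence
    every [xi]-triangle ending in such an object is Hom(-, P(xi))-exact, and
    Gorenstein projectives form the largest class with this vanishing property
    which can be continued to the left and to the right by projectives.  A
    horseshoe argument shows that it is closed under extensions.

    Given K2 -> G1 -> K1 and K1 -> G0 -> A with G0, G1 Gorenstein projective,
    pushing out along G1 -> P, resp. pulling back along P -> G0, replaces
    (G1, G0) by (P, F), resp. (F, P), with P projective and F Gorenstein
    projective; F is an extension of Gorenstein projectives.  Iterating these two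
    exchanges yields the theorem. *)

Require Import Defs.
From Stdlib Require Import IndefiniteDescription.
From mathcomp Require Import all_boot all_order all_algebra.

Set Implicit Arguments.
Unset Strict Implicit.
Unset Printing Implicit Defensive.

Import GRing.Theory.

(** * Additive and suspended categories *)

Section Additive.
Local Open Scope ring_scope.
Variable C : additive_category.
Implicit Types X Y Z : C.

Lemma comp0m X Y Z (f : mor X Y) : (0 : mor Y Z) ∘ f = 0.
Proof. by apply: (addrI (0 ∘ f)); rewrite -composeDl !addr0. Qed.

Lemma compm0 X Y Z (g : mor Y Z) : g ∘ (0 : mor X Y) = 0.
Proof. by apply: (addrI (g ∘ 0)); rewrite -composeDr !addr0. Qed.

Lemma compNm X Y Z (g : mor Y Z) (f : mor X Y) : (- g) ∘ f = - (g ∘ f).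
Proof. by apply: (addrI (g ∘ f)); rewrite -composeDl !subrr comp0m. Qed.

Lemma compmN X Y Z (g : mor Y Z) (f : mor X Y) : g ∘ (- f) = - (g ∘ f).
Proof. by apply: (addrI (g ∘ f)); rewrite -composeDr !subrr compm0. Qed.

Lemma comp_retract_eq0 X Y Z (r : mor Z Y) (s : mor Y Z) (f : mor X Y) :
  r ∘ s = idm Y -> s ∘ f = 0 -> f = 0.
Proof. by move=> rs sf; rewrite -(compose1m f) -rs -composeA sf compm0. Qed.

Lemma comp_section_eq0 X Y Z (r : mor X Y) (s : mor Y X) (f : mor Y Z) :
  r ∘ s = idm Y -> f ∘ r = 0 -> f = 0.
Proof. by move=> rs fr; rewrite -(composem1 f) -rs composeA fr comp0m. Qed.

Lemma is_iso_id X : is_iso (idm X).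
Proof. by exists (idm X); rewrite compose1m. Qed.

Lemma is_isoN X : is_iso (- idm X).
Proof. by exists (- idm X); rewrite compNm compmN opprK compose1m. Qed.

Lemma is_zero_from X Y : is_zero X -> forall f : mor X Y, f = 0.
Proof. by move=> X0 f; rewrite -(composem1 f) X0 compm0. Qed.

End Additive.

Section Suspended.
Local Open Scope ring_scope.
Variable T : suspended_category.
Implicit Types X Y Z : T.

Lemma suspm0 X Y : suspm (0 : mor X Y) = 0.
Proof. by apply: (addrI (suspm 0)); rewrite -suspmD !addr0. Qed.

Lemma suspmN X Y (f : mor X Y) : suspm (- f) = - suspm f.
Proof. by apply: (addrI (suspm f)); rewrite -suspmD !subrr suspm0. Qed.

Lemma suspm_inj X Y : injective (@suspm T X Y).
Proof.
move=> f g efg; rewrite -(compose1m f) -(compose1m g) -(adj_unitK Y).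
by rewrite -!composeA !adj_unit_nat efg.
Qed.

Lemma desuspm_eq0 X Y (f : mor X Y) : desuspm f = 0 -> f = 0.
Proof.
move=> f0; apply: (comp_section_eq0 (adj_counitVK X)).
by rewrite adj_counit_nat f0 suspm0 compm0.
Qed.

Lemma suspm_unitV X : suspm (adj_unitV X) = adj_counit (susp X).
Proof.
rewrite -(composem1 (adj_counit _)) -suspm1 -(adj_unitVK X) suspm_comp composeA.
by rewrite adj_counit_unit compose1m.
Qed.

Lemma suspm_full X Y (y : mor (susp X) (susp Y)) : exists x, suspm x = y.
Proof.
exists (adj_unitV Y ∘ desuspm y ∘ adj_unit X).
rewrite !suspm_comp suspm_unitV -adj_counit_nat -composeA adj_counit_unit.
exact: composem1.
Qed.

Lemma is_zero_susp X : is_zero X -> is_zero (susp X).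
Proof. by rewrite /is_zero -suspm1 => ->; rewrite suspm0. Qed.

End Suspended.

(** * Distinguished triangles *)

Section Triangulated.
Local Open Scope ring_scope.
Variable T : triangulated_category.
Implicit Types A B C D E X Y Z : T.

Lemma dist_fill_mor A B C A' B' C'
    (f : mor A B) (g : mor B C) (h : mor C (susp A))
    (f' : mor A' B') (g' : mor B' C') (h' : mor C' (susp A'))
    (a : mor A A') (b : mor B B') :
  dist (Triangle f g h) -> dist (Triangle f' g' h') -> b ∘ f = f' ∘ a ->
  exists c : mor C C', c ∘ g = g' ∘ b /\ suspm a ∘ h = h' ∘ c.
Proof.
move=> d d' bf.
have [c [_ /= cg ah]] :=
  @dist_fill _ (Triangle f g h) (Triangle f' g' h') a b d d' bf.
by exists c.
Qed.

Lemma dist_isoC A B C C' (f : mor A B) (g : mor B C) (h : mor C (susp A))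
    (c : mor C C') (c' : mor C' C) : c' ∘ c = idm C -> c ∘ c' = idm C' ->
  dist (Triangle f g h) -> dist (Triangle f (c ∘ g) (h ∘ c')).
Proof.
move=> c'c cc'; apply: dist_iso; exists (idm A), (idm B), c; split.
- exact: is_iso_id.
- exact: is_iso_id.
- by exists c'.
- by split; rewrite /= ?suspm1 ?composem1 ?compose1m // -composeA c'c composem1.
Qed.

Lemma dist_isoA A A' B C (f : mor A B) (g : mor B C) (h : mor C (susp A))
    (a : mor A A') (a' : mor A' A) : a' ∘ a = idm A -> a ∘ a' = idm A' ->
  dist (Triangle f g h) -> dist (Triangle (f ∘ a') g (suspm a ∘ h)).
Proof.
move=> a'a aa'; apply: dist_iso; exists a, (idm B), (idm C); split.
- by exists a'.
- exact: is_iso_id.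
- exact: is_iso_id.
- by split; rewrite /= ?suspm1 ?composem1 ?compose1m // -composeA a'a composem1.
Qed.

Lemma dist_oppAB A B C (f : mor A B) (g : mor B C) (h : mor C (susp A)) :
  dist (Triangle f g h) -> dist (Triangle (- f) (- g) h).
Proof.
apply: dist_iso; exists (idm A), (- idm B), (idm C).
split; [exact: is_iso_id|exact: is_isoN|exact: is_iso_id|].
by split; rewrite /= ?suspm1 ?compNm ?compmN ?opprK ?composem1 ?compose1m.
Qed.

Lemma dist_oppBC A B C (f : mor A B) (g : mor B C) (h : mor C (susp A)) :
  dist (Triangle f g h) -> dist (Triangle f (- g) (- h)).
Proof.
apply: dist_iso; exists (idm A), (idm B), (- idm C).
split; [exact: is_iso_id|exact: is_iso_id|exact: is_isoN|].
by split; rewrite /= ?suspm1 ?compNm ?compmN ?opprK ?composem1 ?compose1m.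
Qed.

(** Rotating this triangle gives the original one with [C] replaced by [susp (desusp C)] along the
    counit. *)
Lemma dist_unrotate A B C (f : mor A B) (g : mor B C) (h : mor C (susp A)) :
  dist (Triangle f g h) ->
  dist (Triangle (- (adj_unitV A ∘ desuspm h)) f (adj_counitV C ∘ g)).
Proof.
move=> fgh; apply/dist_rotate; rewrite /rotate /= suspmN opprK suspm_comp.
rewrite suspm_unitV -adj_counit_nat.
by apply: dist_isoC fgh; [exact: adj_counitVK|exact: adj_counitK].
Qed.

Lemma dist_fiber A C (h : mor C (susp A)) :
  exists B (f : mor A B) (g : mor B C), dist (Triangle f g h).
Proof.
have [D [x [y hxy]]] := dist_cone h.
(* Rotating the cone of [h] back twice gives a triangle that starts at [desusp (susp A)]; the unit
   identifies this object with [A]. *)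
have := dist_unrotate (dist_unrotate hxy).
move/(dist_isoA (adj_unitVK A) (adj_unitK A)).
by rewrite suspm_unitV composeA adj_counitVK compose1m; do 3!eexists; eassumption.
Qed.

Lemma dist_0id X Z : is_zero Z ->
  dist (Triangle (0 : mor Z X) (idm X) (0 : mor X (susp Z))).
Proof.
move=> Z0; apply/dist_rotate; rewrite /rotate /= suspm0 oppr0.
apply: dist_iso (dist_id X).
exists (idm X), (idm X), 0; split; try exact: is_iso_id.
  exists 0; rewrite !comp0m zero_objP; split=> //.
  by apply/esym; apply: is_zero_susp.
by split; rewrite /= ?compm0 ?comp0m ?composem1.
Qed.

Lemma dist_id0 X Z : is_zero Z ->
  dist (Triangle (idm X) (0 : mor X Z) (0 : mor Z (susp X))).
Proof.
move=> Z0; apply: dist_iso (dist_id X).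
exists (idm X), (idm X), 0; split; try exact: is_iso_id.
  by exists 0; rewrite !comp0m zero_objP Z0.
by split; rewrite /= ?compm0 ?comp0m ?composem1.
Qed.

Section Exactness.
Variables (A B C : T) (f : mor A B) (g : mor B C) (h : mor C (susp A)).
Hypothesis fgh : dist (Triangle f g h).

Lemma dist_comp_gf : g ∘ f = 0.
Proof.
have [c [<- _]] := dist_fill_mor (dist_id A) fgh (erefl (f ∘ idm A)).
exact: compm0.
Qed.

Lemma dist_lift_f X (b : mor X B) : g ∘ b = 0 -> exists a, f ∘ a = b.
Proof.
move=> gb; have /dist_rotate dX := dist_id X; have /dist_rotate d := fgh.
have [|y [_]] := dist_fill_mor (a := b) (b := 0) dX d.
  by rewrite /= gb comp0m.
have [a <-] := suspm_full y.
rewrite /= suspm1 compmN composem1 compNm -suspm_comp.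
by move=> /oppr_inj /suspm_inj; exists a.
Qed.

Lemma dist_ext_g X (b : mor B X) : b ∘ f = 0 -> exists c, c ∘ g = b.
Proof.
move=> bf; have dX := dist_0id X (zero_objP T).
have [|c [e _]] := dist_fill_mor (a := 0) (b := b) fgh dX.
  by rewrite bf comp0m.
by exists c; rewrite e compose1m.
Qed.

End Exactness.

Section RotatedExactness.
Variables (A B C : T) (f : mor A B) (g : mor B C) (h : mor C (susp A)).
Hypothesis fgh : dist (Triangle f g h).

Lemma dist_rotate1 : dist (Triangle g h (- suspm f)).
Proof. by move/dist_rotate: fgh. Qed.

Lemma dist_rotate2 : dist (Triangle h (- suspm f) (- suspm g)).
Proof. by move/dist_rotate: dist_rotate1. Qed.

Lemma dist_comp_hg : h ∘ g = 0.
Proof. exact: dist_comp_gf dist_rotate1. Qed.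

Lemma dist_comp_fh : suspm f ∘ h = 0.
Proof. by have /eqP := dist_comp_gf dist_rotate2; rewrite compNm oppr_eq0 => /eqP. Qed.

Lemma dist_lift_g X (c : mor X C) : h ∘ c = 0 -> exists b, g ∘ b = c.
Proof. exact: dist_lift_f dist_rotate1 _ c. Qed.

Lemma dist_ext_h X (c : mor C X) : c ∘ g = 0 -> exists d, d ∘ h = c.
Proof. exact: dist_ext_g dist_rotate1 _ c. Qed.

Lemma dist_ext_f X (a : mor A X) : suspm a ∘ h = 0 -> exists b, b ∘ f = a.
Proof.
move=> ah; have [y] := dist_ext_g dist_rotate2 ah; have [b <-] := suspm_full y.
by rewrite compmN -suspm_comp -suspmN => /suspm_inj <-; exists (- b); rewrite compNm.
Qed.

End RotatedExactness.

(* The octahedral axiom for [h ∘ e], where [h] and [h ∘ e] are completed to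
   triangles on the left and [e] on the right. *)
Lemma octahedral_fiber A B C E G Z
    (f : mor A B) (g : mor B C) (h : mor C (susp A))
    (e : mor E C) (i : mor C Z) (j : mor Z (susp E))
    (f' : mor A G) (g' : mor G E) :
  dist (Triangle f g h) -> dist (Triangle e i j) ->
  dist (Triangle f' g' (h ∘ e)) ->
  exists (w : mor G B) (u : mor Z (susp G)),
    [/\ dist (Triangle w (i ∘ g) u), w ∘ f' = f, g ∘ w = e ∘ g' &
        suspm g' ∘ u = j].
Proof.
move=> fgh eij fgh'.
have [u [v [duv [_ nu] [vm lv]]]] :=
  dist_octahedral eij (dist_rotate2 fgh) (dist_rotate2 fgh').
have [w ew] := suspm_full v; subst v; exists w, (- u); split.
- apply/dist_rotate/dist_rotate; rewrite /rotate /=.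
  by move/dist_oppAB: duv; rewrite compmN -suspm_comp.
- by move: vm; rewrite compmN -suspm_comp => /oppr_inj /suspm_inj.
- by move: lv; rewrite compmN compNm -!suspm_comp => /oppr_inj /suspm_inj.
- by rewrite compmN -compNm.
Qed.

Lemma base_change_exists A B C E G M
    (f : mor A B) (g : mor B C) (h : mor C (susp A))
    (d : mor M E) (e : mor E C) (z : mor C (susp M))
    (f' : mor A G) (g' : mor G E) :
  dist (Triangle f g h) -> dist (Triangle d e z) ->
  dist (Triangle f' g' (h ∘ e)) ->
  exists (d' : mor M G) (b : mor G B),
    is_base_change f g h e f' g' (h ∘ e) d z d' b (z ∘ g).
Proof.
move=> fgh dez fgh'.
have [b [u [dbu bf gb gu]]] := octahedral_fiber fgh (dist_rotate1 dez) fgh'.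
(* The cone of [b] is [susp M], so [u] runs between suspensions and comes from a map [M -> G]; the
   sign is that of rotation. *)
have [d' ed] := suspm_full u; subst u; exists (- d'), b.
have dd : dist (Triangle (- d') b (z ∘ g)).
  by apply/dist_rotate; rewrite /rotate /= suspmN opprK.
split; [by []|by []|by split; rewrite /= ?suspm1 ?composem1 ?compose1m|].
split; rewrite /= ?suspm1 ?composem1 ?compose1m //.
by apply: suspm_inj; rewrite compmN suspmN suspm_comp gu opprK.
Qed.

(** The octahedron used is that of [h] followed by [- suspm a], both rotated into connecting
    position; [F] is the fibre of the composite. *)
Lemma cobase_change_exists A B C D F N
    (f : mor A B) (g : mor B C) (h : mor C (susp A))
    (a : mor A D) (d : mor D N) (z : mor N (susp A))
    (f' : mor D F) (g' : mor F C) :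
  dist (Triangle f g h) -> dist (Triangle a d z) ->
  dist (Triangle f' g' (suspm a ∘ h)) ->
  exists (b : mor B F) (d' : mor F N),
    dist (Triangle b d' (- (suspm f ∘ z))).
Proof.
move=> fgh adz fgh'; move/dist_oppBC: fgh'; rewrite -compNm => fgh'.
have [w [u [dwu _ _ _]]] :=
  octahedral_fiber (dist_rotate1 adz) (dist_rotate2 fgh) fgh'.
have [b eb] := suspm_full u; subst u; exists (- b), w.
by apply/dist_rotate; rewrite /rotate /= suspmN opprK -compNm.
Qed.

End Triangulated.

(** * Ghost morphisms *)

Section Ghosts.
Local Open Scope ring_scope.
Variables (T : triangulated_category) (xi : triangle_class T).
Hypotheses (xi_proper : proper_class xi) (xi_enough : enough_projectives xi).
Implicit Types A B C D E P Q X Y Z : T.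

Definition ghost C D (h : mor C D) : Prop :=
  forall P (p : mor P C), xi_projective xi P -> h ∘ p = 0.

Definition kills_ghosts X Y : Prop := forall phi : mor X Y, ghost phi -> phi = 0.

Lemma ghost_compl C D E (k : mor D E) (h : mor C D) : ghost h -> ghost (k ∘ h).
Proof. by move=> gh P p pP; rewrite -composeA gh // compm0. Qed.

Lemma ghost_compr C D E (k : mor D E) (h : mor C D) : ghost k -> ghost (k ∘ h).
Proof. by move=> gk P p pP; rewrite -composeA gk. Qed.

Lemma ghostN C D (h : mor C D) : ghost h -> ghost (- h).
Proof. by move=> gh P p pP; rewrite compNm gh // oppr0. Qed.

Lemma xi_dist A B C (f : mor A B) (g : mor B C) (h : mor C (susp A)) :
  xi (Triangle f g h) -> dist (Triangle f g h).
Proof. exact: proper_dist. Qed.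

Lemma xi_ghost A B C (f : mor A B) (g : mor B C) (h : mor C (susp A)) :
  xi (Triangle f g h) -> ghost h.
Proof.
move=> xt P p /(_ _ xt) [_ _ /(_ p) [b /= <-]].
by rewrite composeA (dist_comp_hg (xi_dist xt)) comp0m.
Qed.

(* Such a triangle splits; it is obtained as a base change of the standard
   split triangle. *)
Lemma xi_zero A B C (f : mor A B) (g : mor B C) :
  dist (Triangle f g 0) -> xi (Triangle f g 0).
Proof.
move=> fg0.
have xs : xi (Triangle (in1 A C) (pr2 A C) (0 : mor C (susp A))).
  apply: proper_split => //; exists A, C, (idm _), (idm _), (idm _).
  split; try exact: is_iso_id.
  by split; rewrite /= ?suspm1 ?composem1 ?compose1m.
have fg0' : dist (Triangle f g (0 ∘ idm C)) by rewrite comp0m.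
have [d' [b bc]] :=
  base_change_exists (xi_dist xs) (dist_0id C (zero_objP T)) fg0'.
by have := proper_base_change xi_proper bc xs; rewrite comp0m.
Qed.

(* Saturation, applied to a [xi]-deflation from a projective onto [C]. *)
Lemma ghost_xi A B C (f : mor A B) (g : mor B C) (h : mor C (susp A)) :
  dist (Triangle f g h) -> ghost h -> xi (Triangle f g h).
Proof.
move=> fgh gh; have [K [P [k [p [z [pP xp]]]]]] := xi_enough C.
have [G [f' [g' fgh']]] := dist_fiber (h ∘ p).
have [d' [b bc]] := base_change_exists fgh (xi_dist xp) fgh'.
apply: (proper_saturated xi_proper bc xp).
by move: fgh'; rewrite gh //; apply: xi_zero.
Qed.

Lemma ghost_fiber A C (h : mor C (susp A)) : ghost h ->
  exists B (f : mor A B) (g : mor B C), xi (Triangle f g h).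
Proof.
move=> gh; have [B [f [g fgh]]] := dist_fiber h.
by exists B, f, g; apply: ghost_xi.
Qed.

Lemma projective_kills_ghosts P : xi_projective xi P -> forall Y, kills_ghosts P Y.
Proof. by move=> pP Y phi gphi; rewrite -(composem1 phi) gphi. Qed.

(** The hypothesis is surjectivity of Hom(P, g). Injectivity of Hom(P, f) is the same condition for
    the desuspended triangle, whose last map is up to isomorphism the one preceding [f]. *)
Lemma xi_projectiveI P :
  (forall A B C (f : mor A B) (g : mor B C) (h : mor C (susp A)),
     xi (Triangle f g h) -> forall p : mor P C, h ∘ p = 0) ->
  xi_projective xi P.
Proof.
move=> hp [A B C f g h] xt /=; have fgh := xi_dist xt; split.
- move=> a a' eqa; apply/eqP; rewrite -subr_eq0; apply/eqP.
  have : f ∘ (a - a') = 0 by rewrite composeDr compmN eqa subrr.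
  move=> /(dist_lift_f (dist_unrotate fgh)) [c <-].
  have := hp _ _ _ _ _ _ (proper_shift xi_proper (Negz 0) xt) c.
  rewrite /= !compNm -!composeA => /eqP; rewrite !oppr_eq0 => /eqP hc.
  by rewrite (comp_retract_eq0 (adj_counitVK A) hc) oppr0.
- move=> b; split; first exact: (dist_lift_f fgh).
  by move=> [a <-]; rewrite composeA (dist_comp_gf fgh) comp0m.
- by move=> c; apply: (dist_lift_g fgh); apply: hp xt c.
Qed.

Lemma kills_ghosts_projective P : (forall Y, kills_ghosts P Y) -> xi_projective xi P.
Proof.
move=> kP; apply: xi_projectiveI => A B C f g h xt p.
by apply: kP; apply/ghost_compr/xi_ghost/xt.
Qed.

(** A map out of [susp Q] corresponds to a map out of [Q] into the desuspended triangle, which is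
    again in [xi]. *)
Lemma projective_susp Q : xi_projective xi Q -> xi_projective xi (susp Q).
Proof.
move=> pQ; apply: xi_projectiveI => A B C f g h xt p.
have xd := proper_shift xi_proper (Negz 0) xt.
have /eqP := xi_ghost xd (desuspm p ∘ adj_unit Q) pQ.
rewrite compNm oppr_eq0 -!composeA => /eqP.
move/(comp_retract_eq0 (adj_counitVK _)) => /(comp_retract_eq0 (adj_unitVK _)).
rewrite composeA -desuspm_comp => hp.
by apply: desuspm_eq0; apply: comp_section_eq0 (adj_unitVK _) hp.
Qed.

Lemma susp_monic_projective P A B C (f : mor A B) (g : mor B C) (h : mor C (susp A)) :
  xi (Triangle f g h) -> xi_projective xi P ->
  forall x : mor P (susp A), suspm f ∘ x = 0 -> x = 0.
Proof.
move=> xt pP x fx; have [inj _ _] := pP _ (proper_shift xi_proper (Posz 1) xt).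
by apply: inj; rewrite /= compNm fx oppr0 compm0.
Qed.

Lemma kills_ghosts_ext A B C Y (f : mor A B) (g : mor B C) (h : mor C (susp A)) :
  xi (Triangle f g h) -> kills_ghosts A Y -> kills_ghosts C Y -> kills_ghosts B Y.
Proof.
move=> xt kA kC phi gphi; have fgh := xi_dist xt.
have [c ec] := dist_ext_g fgh (kA _ (ghost_compr f gphi)).
(* The factor [c] of [phi] through [g] is ghost too, since maps from projectives to [C] lift along
   [g]. *)
rewrite -ec (kC c) ?comp0m // => P p pP.
have [b eb] := dist_lift_g fgh (xi_ghost xt p pP).
by rewrite -eb composeA ec gphi.
Qed.

Lemma projective_ext A B C (f : mor A B) (g : mor B C) (h : mor C (susp A)) :
  xi (Triangle f g h) -> xi_projective xi A -> xi_projective xi C ->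
  xi_projective xi B.
Proof.
move=> xt pA pC; apply: kills_ghosts_projective => Y.
by apply: kills_ghosts_ext xt _ _; apply: projective_kills_ghosts.
Qed.

(** Both obstructions are ghosts from [C] to a projective: a map killed by [g], and the obstruction
    [suspm a ∘ h] to extending [a] along [f], with values in the projective [susp Q]. *)
Lemma hom_proj_exactI A B C (f : mor A B) (g : mor B C) (h : mor C (susp A)) :
  xi (Triangle f g h) -> (forall Q, xi_projective xi Q -> kills_ghosts C Q) ->
  hom_proj_exact xi (Triangle f g h).
Proof.
move=> xt kC Q pQ /=; have fgh := xi_dist xt; split.
- move=> c c' eqc; apply/eqP; rewrite -subr_eq0; apply/eqP.
  have cg : (c - c') ∘ g = 0 by rewrite composeDl compNm eqc subrr.
  apply: kC => // P p pP; have [b <-] := dist_lift_g fgh (xi_ghost xt p pP).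
  by rewrite composeA cg comp0m.
- move=> b; split; first exact: (dist_ext_g fgh).
  by move=> [c <-]; rewrite -composeA (dist_comp_gf fgh) compm0.
- move=> a; apply: (dist_ext_f fgh); apply: kC (projective_susp pQ) _ _.
  exact/ghost_compl/xi_ghost/xt.
Qed.

(** Maps from projectives lift along [q] and then along [p], so the last map of the composite's
    triangle is ghost. *)
Lemma deflation_comp K1 X Y K2 Z L
    (k1 : mor K1 X) (p : mor X Y) (h1 : mor Y (susp K1))
    (k2 : mor K2 Y) (q : mor Y Z) (h2 : mor Z (susp K2))
    (f : mor K1 L) (g : mor L K2) :
  xi (Triangle k1 p h1) -> xi (Triangle k2 q h2) ->
  dist (Triangle f g (h1 ∘ k2)) ->
  xi (Triangle f g (h1 ∘ k2)) /\
  exists (w : mor L X) (u : mor Z (susp L)), xi (Triangle w (q ∘ p) u).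
Proof.
move=> x1 x2 fgh; split.
  exact/(ghost_xi fgh)/ghost_compr/xi_ghost/x1.
have [w [u [dw _ _ _]]] := octahedral_fiber (xi_dist x1) (xi_dist x2) fgh.
exists w, u; apply: (ghost_xi dw) => P z pP.
have [y <-] := dist_lift_g (xi_dist x2) (xi_ghost x2 z pP).
have [x <-] := dist_lift_g (xi_dist x1) (xi_ghost x1 y pP).
by rewrite (composeA q p x) composeA (dist_comp_hg dw) comp0m.
Qed.

(** Ghosts are not self-dual, so [n] is handled differently from the case of deflations:
    [suspm f ∘ n = l ∘ v] is ghost, and [suspm f] is monic on maps from projectives. *)
Lemma inflation_comp A B C X Z
    (f : mor A B) (i : mor B Z) (j : mor Z (susp A))
    (g : mor B C) (k : mor C X) (l : mor X (susp B)) :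
  xi (Triangle f i j) -> xi (Triangle g k l) ->
  exists Y (m : mor C Y) (n : mor Y (susp A)) (u : mor Z Y) (v : mor Y X),
    xi (Triangle (g ∘ f) m n) /\ xi (Triangle u v (suspm i ∘ l)).
Proof.
move=> xf xg; have [Y [m [n dgf]]] := dist_cone (g ∘ f).
have [u [v [duv _ [_ lv]]]] := dist_octahedral (xi_dist xf) (xi_dist xg) dgf.
exists Y, m, n, u, v; split; apply: ghost_xi => //; last first.
  exact/ghost_compl/xi_ghost/xg.
move=> P p pP; apply: (susp_monic_projective xf) => //.
by rewrite composeA -lv -composeA (xi_ghost xg).
Qed.

Lemma xi_base_change A B C E M
    (f : mor A B) (g : mor B C) (h : mor C (susp A))
    (d : mor M E) (e : mor E C) (z : mor C (susp M)) :
  xi (Triangle f g h) -> xi (Triangle d e z) ->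
  exists G (f' : mor A G) (g' : mor G E) (d' : mor M G) (b : mor G B),
    xi (Triangle f' g' (h ∘ e)) /\ xi (Triangle d' b (z ∘ g)).
Proof.
move=> xf xd; have ghe : ghost (h ∘ e) by apply/ghost_compr/xi_ghost/xf.
have [G [f' [g' xf']]] := ghost_fiber ghe.
have [d' [b [_ [_ db] _ _]]] :=
  base_change_exists (xi_dist xf) (xi_dist xd) (xi_dist xf').
exists G, f', g', d', b; split=> //.
exact/(ghost_xi db)/ghost_compr/xi_ghost/xd.
Qed.

Lemma xi_cobase_change A B C D N
    (f : mor A B) (g : mor B C) (h : mor C (susp A))
    (a : mor A D) (d : mor D N) (z : mor N (susp A)) :
  xi (Triangle f g h) -> xi (Triangle a d z) ->
  exists F (f' : mor D F) (g' : mor F C) (b : mor B F) (d' : mor F N),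
    xi (Triangle f' g' (suspm a ∘ h)) /\ xi (Triangle b d' (- (suspm f ∘ z))).
Proof.
move=> xf xa; have gah : ghost (suspm a ∘ h) by apply/ghost_compl/xi_ghost/xf.
have [F [f' [g' xf']]] := ghost_fiber gah.
have [b [d' db]] := cobase_change_exists (xi_dist xf) (xi_dist xa) (xi_dist xf').
exists F, f', g', b, d'; split=> //.
exact/(ghost_xi db)/ghostN/ghost_compl/xi_ghost/xa.
Qed.

End Ghosts.

(** * Gorenstein projective objects *)

Section Gorenstein.
Local Open Scope ring_scope.
Variables (T : triangulated_category) (xi : triangle_class T).
Hypotheses (xi_proper : proper_class xi) (xi_enough : enough_projectives xi).
Implicit Types A B C P Q X Y Z : T.

Let GP := gorenstein_projective xi.

(** One link of a complete resolution, packaged existentially so that resolutions can be built link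
    by link. *)
Definition hom_exact_step (K' K : T) : Prop :=
  exists (P : T) (f : mor K' P) (g : mor P K) (h : mor K (susp K')),
    [/\ xi_projective xi P, xi (Triangle f g h) &
        hom_proj_exact xi (Triangle f g h)].

Lemma gorenstein_projective_seq A (K : int -> T) :
  (forall m, hom_exact_step (K (m + 1)) (K m)) -> K 0 = A -> GP A.
Proof.
move=> step K0.
pose P_ m := constructive_indefinite_description _ (step m).
pose f_ m := constructive_indefinite_description _ (proj2_sig (P_ m)).
pose g_ m := constructive_indefinite_description _ (proj2_sig (f_ m)).
pose h_ m := constructive_indefinite_description _ (proj2_sig (g_ m)).
exists K, (fun m => sval (P_ m)), (fun m => sval (f_ m)).
exists (fun m => sval (g_ m)), (fun m => sval (h_ m)); split=> // m.
exact: svalP (h_ m).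
Qed.

Lemma gorenstein_projective_coind (W : T -> Prop) :
  (forall B, W B -> exists B', W B' /\ hom_exact_step B' B) ->
  (forall B, W B -> exists B', W B' /\ hom_exact_step B B') ->
  forall A, W A -> GP A.
Proof.
move=> left right A WA.
(* Neighbours are chosen inside the subtype, so that the choice can be iterated. *)
pose S := {B : T | W B}.
have choose (R : T -> T -> Prop) :
    (forall B, W B -> exists B', W B' /\ R B B') ->
    exists F : S -> S, forall s, R (sval s) (sval (F s)).
  move=> RW; have Rs (s : S) : exists s' : S, R (sval s) (sval s').
    by have [B' [WB' RB]] := RW _ (svalP s); exists (exist _ B' WB').
  exists (fun s => sval (constructive_indefinite_description _ (Rs s))) => s.
  exact: svalP (constructive_indefinite_description _ (Rs s)).
have [F stepF] := choose (fun B B' => hom_exact_step B' B) left.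
have [G stepG] := choose hom_exact_step right.
pose s0 : S := exist _ A WA.
pose K (m : int) := sval match m with
  | Posz n => iter n F s0
  | Negz n => iter n.+1 G s0
  end.
(* The cases are degree [n], degree -1, where the right half meets [A], and degree [-(n+2)]. *)
apply: (@gorenstein_projective_seq A K) => // -[n|[|n]].
- by rewrite -PoszD addn1; apply: stepF.
- exact: stepG.
- have -> : Negz n.+1 + 1 = Negz n by rewrite !NegzE -[n.+2]addn1 PoszD opprD addrNK.
  exact: stepG.
Qed.

Lemma gorenstein_projective_shift (K : int -> T) m :
  (forall m, hom_exact_step (K (m + 1)) (K m)) -> GP (K m).
Proof.
move=> step; apply: (@gorenstein_projective_seq _ (fun i => K (m + i))).
  by move=> i; rewrite addrA.
by rewrite addr0.
Qed.

Lemma gorenstein_projective_step A : GP A ->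
  (exists A', GP A' /\ hom_exact_step A' A) /\
  (exists A', GP A' /\ hom_exact_step A A').
Proof.
move=> [K [P [f [g [h [step <-]]]]]].
have stepK m : hom_exact_step (K (m + 1)) (K m).
  by exists (P m), (f m), (g m), (h m).
split; [exists (K (0 + 1))|exists (K (-1))].
  by split; [apply: gorenstein_projective_shift|apply: stepK].
split; first exact: gorenstein_projective_shift.
by have := stepK (-1); rewrite addNr.
Qed.

(** A ghost dies after precomposition with [g : P -> C] from the complete resolution, and
    Hom-exactness makes precomposition with [g] injective on maps to [Q]. *)
Lemma gp_kills_ghosts C Q : GP C -> xi_projective xi Q -> kills_ghosts xi C Q.
Proof.
move=> /gorenstein_projective_step [[C1 [_ [P [f [g [h [pP _ ex]]]]]]] _] pQ phi gphi.
by have [inj _ _] := ex Q pQ; apply: inj; rewrite /= gphi // comp0m.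
Qed.

Lemma gp_closed_coind (W : T -> Prop) :
  (forall B Q, W B -> xi_projective xi Q -> kills_ghosts xi B Q) ->
  (forall B, W B -> exists B' P (f : mor B' P) (g : mor P B) (h : mor B (susp B')),
     [/\ W B', xi_projective xi P & xi (Triangle f g h)]) ->
  (forall B, W B -> exists B' P (f : mor B P) (g : mor P B') (h : mor B' (susp B)),
     [/\ W B', xi_projective xi P & xi (Triangle f g h)]) ->
  forall A, W A -> GP A.
Proof.
move=> kW left right; apply: gorenstein_projective_coind => B WB.
  have [B' [P [f [g [h [WB' pP xt]]]]]] := left B WB; exists B'; split=> //.
  by exists P, f, g, h; split=> //; apply: hom_proj_exactI => // Q; apply: kW.
have [B' [P [f [g [h [WB' pP xt]]]]]] := right B WB; exists B'; split=> //.
by exists P, f, g, h; split=> //; apply: hom_proj_exactI => // Q; apply: kW.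
Qed.

(** Coinduction on the class of projectives, with the zero object as neighbour on either side. *)
Lemma projective_gp P : xi_projective xi P -> GP P.
Proof.
move: P; apply: gp_closed_coind => P.
- by move=> Q pP _; apply: projective_kills_ghosts.
- move=> pP; exists zero_obj, P, 0, (idm P), 0; split=> //.
    apply: kills_ghosts_projective => // Y phi _.
    exact: (is_zero_from (zero_objP T)).
  by apply: xi_zero => //; apply/dist_0id/zero_objP.
- move=> pP; exists zero_obj, P, (idm P), 0, 0; split=> //.
    apply: kills_ghosts_projective => // Y phi _.
    exact: (is_zero_from (zero_objP T)).
  by apply: xi_zero => //; apply/dist_id0/zero_objP.
Qed.

(** Left half of the horseshoe: [X] is an extension of [Q] by [P] that maps onto [B], with kernel
    [L] an extension of [C1] by [A1]. *)
Lemma ext_projective_left A B C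
    (f : mor A B) (g : mor B C) (h : mor C (susp A))
    A1 P (a1 : mor A1 P) (a2 : mor P A) (da : mor A (susp A1))
    C1 Q (c1 : mor C1 Q) (c2 : mor Q C) (dc : mor C (susp C1)) :
  xi (Triangle f g h) -> xi (Triangle a1 a2 da) -> xi (Triangle c1 c2 dc) ->
  xi_projective xi P -> xi_projective xi Q ->
  exists L X, xi_projective xi X /\
    (exists (w : mor L X) (x : mor X B) u, xi (Triangle w x u)) /\
    (exists (l : mor A1 L) (l' : mor L C1) v, xi (Triangle l l' v)).
Proof.
move=> xf xa xc pP pQ.
have [G [f' [g' [d' [b [xG xb]]]]]] := xi_base_change xi_proper xi_enough xf xc.
(* Pulled back to the projective [Q], the extension splits, with retraction [r : G -> A]; [X] is
   then the pullback of [P -> A] along [r]. *)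
rewrite (xi_ghost xi_proper xf c2 pQ) in xG.
have [|r rf] := dist_ext_f (xi_dist xi_proper xG) (a := idm A).
  by rewrite compm0.
have gda : ghost xi (da ∘ r) by apply/ghost_compr/(xi_ghost xi_proper xa).
have [X [x1 [x2 xX]]] := ghost_fiber xi_proper xi_enough gda.
have aP : dist (Triangle a1 a2 (da ∘ r ∘ f')).
  by rewrite -composeA rf composem1; apply: xi_dist xa.
have [_ [w [u xPX]]] := deflation_comp xi_proper xi_enough xX xG aP.
have [L [l [l' dL]]] := dist_fiber (da ∘ r ∘ d').
have [xL [w' [u' xLX]]] := deflation_comp xi_proper xi_enough xX xb dL.
exists L, X; split; first exact: projective_ext xPX pP pQ.
by split; [exists w', (b ∘ x2), u'|exists l, l', (da ∘ r ∘ d')].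
Qed.

(** Right half of the horseshoe. Projectivity of [P] does not by itself split the pushout along
    [A -> P]; its last map is a ghost from [C] to [susp P], which [kC] kills. *)
Lemma ext_projective_right A B C
    (f : mor A B) (g : mor B C) (h : mor C (susp A))
    A' P (a1 : mor A P) (a2 : mor P A') (da : mor A' (susp A))
    C' Q (c1 : mor C Q) (c2 : mor Q C') (dc : mor C' (susp C)) :
  xi (Triangle f g h) -> xi (Triangle a1 a2 da) -> xi (Triangle c1 c2 dc) ->
  xi_projective xi P -> xi_projective xi Q -> kills_ghosts xi C (susp P) ->
  exists L X, xi_projective xi X /\
    (exists (w : mor B X) (x : mor X L) u, xi (Triangle w x u)) /\
    (exists (l : mor A' L) (l' : mor L C') v, xi (Triangle l l' v)).
Proof.
move=> xf xa xc pP pQ kC.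
have [F [f' [g' [b [d' [xF xb]]]]]] := xi_cobase_change xi_proper xi_enough xf xa.
have ah0 : suspm a1 ∘ h = 0.
  by apply/kC/ghost_compl/(xi_ghost xi_proper xf).
rewrite ah0 in xF; have dF := xi_dist xi_proper xF.
have [|s gs] := dist_lift_g dF (c := idm C); first by rewrite comp0m.
have [N [d [z dN]]] := dist_cone s.
have z0 : z = 0.
  apply: (comp_retract_eq0 (r := suspm g') (s := suspm s)).
    by rewrite -suspm_comp gs suspm1.
  exact: dist_comp_fh dN.
subst z; have xN := xi_zero xi_proper dN.
(* [N] is a complement of [C] in [F], hence a copy of [P]. A ghost on [N], pulled back to [F],
   vanishes on [P], so it factors through [g']; the section [s] shows that the factor is zero. *)
have pN : xi_projective xi N.
  apply: kills_ghosts_projective => // Y phi gphi.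
  have phid : phi ∘ d = 0.
    have [|psi epsi] := dist_ext_g dF (b := phi ∘ d).
      exact/(projective_kills_ghosts pP)/ghost_compr/ghost_compr.
    rewrite -epsi -[psi]composem1 -gs composeA epsi -[phi ∘ d ∘ s]composeA.
    by rewrite (dist_comp_gf dN) compm0 comp0m.
  have [y <-] := dist_ext_h dN phid; exact: compm0.
(* Pushing [C -> Q] out along [s] makes [X] an extension of [N] by [Q]; [B] embeds in it through
   [F]. *)
have [X [x1 [x2 [q [n [xX xQ]]]]]] := xi_cobase_change xi_proper xi_enough xc xN.
have [L [m [y [l [l' [xL xA]]]]]] := inflation_comp xi_proper xi_enough xb xX.
exists L, X; split; first exact: projective_ext xQ pQ pN.
by split; [exists (x1 ∘ b), m, y|exists l, l', (suspm d' ∘ (suspm s ∘ dc))].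
Qed.

(** Coinduction on the class of all extensions of Gorenstein projectives: the horseshoe produces
    neighbours that are again such extensions. *)
Lemma gp_ext A B C (f : mor A B) (g : mor B C) (h : mor C (susp A)) :
  xi (Triangle f g h) -> GP A -> GP C -> GP B.
Proof.
move=> xf gA gC.
pose W B := exists A C (f : mor A B) (g : mor B C) (h : mor C (susp A)),
  [/\ GP A, GP C & xi (Triangle f g h)].
suff WGP X : W X -> GP X by apply: WGP; exists A, C, f, g, h.
move: X; apply: gp_closed_coind.
- move=> X Q [A' [C' [f' [g' [h' [gA' gC' xf']]]]]] pQ.
  by apply: kills_ghosts_ext xf' _ _ => //; apply: gp_kills_ghosts.
- move=> X [A' [C' [f' [g' [h' [gA' gC' xf']]]]]].
  have [[A1 [gA1 [P [a1 [a2 [da [pP xa _]]]]]]] _] := gorenstein_projective_step gA'.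
  have [[C1 [gC1 [Q [c1 [c2 [dc [pQ xc _]]]]]]] _] := gorenstein_projective_step gC'.
  have [L [Y [pY [[w [x [u xw]]] [l [l' [v xl]]]]]]] :=
    ext_projective_left xf' xa xc pP pQ.
  by exists L, Y, w, x, u; split=> //; exists A1, C1, l, l', v.
- move=> X [A' [C' [f' [g' [h' [gA' gC' xf']]]]]].
  have [_ [A1 [gA1 [P [a1 [a2 [da [pP xa _]]]]]]]] := gorenstein_projective_step gA'.
  have [_ [C1 [gC1 [Q [c1 [c2 [dc [pQ xc _]]]]]]]] := gorenstein_projective_step gC'.
  have kC : kills_ghosts xi C' (susp P).
    by apply: gp_kills_ghosts => //; apply: projective_susp.
  have [L [Y [pY [[w [x [u xw]]] [l [l' [v xl]]]]]]] :=
    ext_projective_right xf' xa xc pP pQ kC.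
  by exists L, Y, w, x, u; split=> //; exists A1, C1, l, l', v.
Qed.

Lemma gp_step_projective K2 G1 K1 G0 A
    (k2 : mor K2 G1) (g1 : mor G1 K1) (h1 : mor K1 (susp K2))
    (k1 : mor K1 G0) (g0 : mor G0 A) (h0 : mor A (susp K1)) :
  xi (Triangle k2 g1 h1) -> xi (Triangle k1 g0 h0) -> GP G1 -> GP G0 ->
  exists L P F, [/\ xi_projective xi P, GP F,
    exists (a : mor K2 P) (b : mor P L) c, xi (Triangle a b c) &
    exists (a : mor L F) (b : mor F A) c, xi (Triangle a b c)].
Proof.
move=> x1 x0 gG1 gG0.
have [_ [G' [gG' [P [p [q [r [pP xp _]]]]]]]] := gorenstein_projective_step gG1.
(* [L] is the cone of [K2 -> G1 -> P]. It contains [K1] with quotient [G'], so the pushout [F] of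
   [G0] along [K1 -> L] is an extension of [G'] by [G0]. *)
have [L [m [n [u [v [xL xu]]]]]] := inflation_comp xi_proper xi_enough x1 xp.
have [F [f' [g' [b [d' [xF xb]]]]]] := xi_cobase_change xi_proper xi_enough x0 xu.
exists L, P, F; split=> //.
- exact: gp_ext xb gG0 gG'.
- by exists (p ∘ k2), m, n.
- by exists f', g', (suspm u ∘ h0).
Qed.

Lemma projective_step_gp K2 G1 K1 G0 A
    (k2 : mor K2 G1) (g1 : mor G1 K1) (h1 : mor K1 (susp K2))
    (k1 : mor K1 G0) (g0 : mor G0 A) (h0 : mor A (susp K1)) :
  xi (Triangle k2 g1 h1) -> xi (Triangle k1 g0 h0) -> GP G1 -> GP G0 ->
  exists X P F, [/\ xi_projective xi P, GP F,
    exists (a : mor K2 F) (b : mor F X) c, xi (Triangle a b c) &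
    exists (a : mor X P) (b : mor P A) c, xi (Triangle a b c)].
Proof.
move=> x1 x0 gG1 gG0.
have [[G' [gG' [P [p [q [r [pP xp _]]]]]]] _] := gorenstein_projective_step gG0.
(* [X] is the kernel of [P -> G0 -> A] and maps onto [K1] with kernel [G'], so its pullback [F]
   along [G1 -> K1] is an extension of [G1] by [G']. *)
have [X [s [t dX]]] := dist_fiber (r ∘ k1).
have [xX [w [u xw]]] := deflation_comp xi_proper xi_enough xp x0 dX.
have [F [f' [g' [d' [b [xF xb]]]]]] := xi_base_change xi_proper xi_enough xX x1.
exists X, P, F; split=> //.
- exact: gp_ext xF gG' gG1.
- by exists d', b, (h1 ∘ t).
- by exists w, (g0 ∘ q), u.
Qed.

End Gorenstein.

(** * Resolutions *)

Section Resolutions.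
Variables (T : triangulated_category) (xi : triangle_class T).
Implicit Types (A K X : T) (Q : nat -> T -> Prop).

(** Recursive form of a [xi]-exact sequence with a condition [Q j] on its [j]-th term, suited to
    exchanging the first two terms; the tail resolves the first syzygy, hence the shift of [Q]. *)
Fixpoint resolution (n : nat) Q A : Prop :=
  exists K X (f : mor K X) (g : mor X A) (h : mor A (susp K)),
    [/\ Q 0 X, xi (Triangle f g h) &
        if n is n'.+1 then resolution n' (fun j => Q j.+1) K else is_zero K].

Lemma resolution_mono n Q Q' A :
  (forall j X, j <= n -> Q j X -> Q' j X) -> resolution n Q A -> resolution n Q' A.
Proof.
elim: n Q Q' A => [|n IH] Q Q' A QQ' /= [K [X [f [g [h [QX xf rK]]]]]].
  by exists K, X, f, g, h; split; first exact: QQ'.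
exists K, X, f, g, h; split; [exact: QQ'|by []|].
by apply: IH rK => j Y jn; apply: QQ'.
Qed.

Lemma resolution_of_exact n Q A (X : augmented_seq A) :
  xi_exact xi n X -> (forall j, j <= n -> Q j (seq_obj X j)) -> resolution n Q A.
Proof.
move=> [K [f [g [h [xf K0 _ _]]]]] QX.
(* Induction on the distance [d] from the [i]-th syzygy to the end of the sequence. *)
suff res d : forall i Q', i + d = n ->
    (forall j, j <= d -> Q' j (seq_obj X (i + j))) ->
    resolution d Q' (syzygy A K i).
  exact: (res n 0).
elim: d => [|d IH] i Q' idn Q'X.
  rewrite addn0 in idn; subst i; exists (K n), (seq_obj X n), (f n), (g n), (h n).
  by split; [have := Q'X 0 isT; rewrite addn0|apply: xf|].
have lei : i <= n by rewrite -idn leq_addr.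
exists (K i), (seq_obj X i), (f i), (g i), (h i); split.
- by have := Q'X 0 isT; rewrite addn0.
- exact: xf.
- apply: (IH i.+1); first by rewrite addSnnS.
  by move=> j jd; rewrite addSnnS; apply: Q'X.
Qed.

Lemma exact_of_resolution n Q A : resolution n Q A ->
  exists X : augmented_seq A,
    xi_exact xi n X /\ forall j, j <= n -> Q j (seq_obj X j).
Proof.
elim: n Q A => [|n IH] Q A /= [K [X0 [f [g [h [QX0 xf rK]]]]]].
  (* Indices beyond the end are filled with zero objects and zero maps. *)
  pose obj j := if j is _.+1 then zero_obj else X0.
  pose S := @AugmentedSeq T A obj (fun j => 0%R) g; exists S; split; last by case.
  pose Kz := syzygy K (fun _ => zero_obj).
  exists Kz.
  exists (fun j => match j return mor (syzygy A Kz j.+1) (obj j) with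
            | 0 => f | _.+1 => 0%R end).
  exists (fun j => match j return mor (obj j) (syzygy A Kz j) with
            | 0 => g | _.+1 => 0%R end).
  exists (fun j => match j return mor (syzygy A Kz j) (susp (syzygy A Kz j.+1)) with
            | 0 => h | _.+1 => 0%R end).
  by split=> //; case.
have [X [[K' [f' [g' [h' [xf' K'0 diff aug]]]]] QX]] := IH _ _ rK.
pose obj j := if j is j'.+1 then seq_obj X j' else X0.
pose dif j : mor (obj j.+1) (obj j) :=
  match j return mor (obj j.+1) (obj j) with
  | 0 => f ∘ seq_aug X
  | j'.+1 => seq_diff X j'
  end.
exists (@AugmentedSeq T A obj dif g); split; last by case.
(* With [K] prepended, [syzygy A Ks j.+1] is [syzygy K K' j] by computation, so the data of the tail
   can be reused without transport. *)
pose Ks := syzygy K K'.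
exists Ks.
exists (fun j => match j return mor (syzygy A Ks j.+1) (obj j) with
          | 0 => f | j'.+1 => f' j' end).
exists (fun j => match j return mor (obj j) (syzygy A Ks j) with
          | 0 => g | j'.+1 => g' j' end).
exists (fun j => match j return mor (syzygy A Ks j) (susp (syzygy A Ks j.+1)) with
          | 0 => h | j'.+1 => h' j' end).
split=> //; first by case=> // j; apply: xf'.
by case=> [|j] /= jn; [rewrite aug|apply: diff].
Qed.

End Resolutions.

(** * Moving projective terms along Gorenstein projective resolutions *)

Section GorensteinResolutions.
Variables (T : triangulated_category) (xi : triangle_class T).
Hypotheses (xi_proper : proper_class xi) (xi_enough : enough_projectives xi).
Implicit Types A : T.

Let GP := gorenstein_projective xi.

(** By induction the tail has its only non-projective term in front; one exchange moves that term to
    index 0. *)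
Lemma resolution_gp_head n A :
  resolution xi n (fun _ => GP) A ->
  resolution xi n (fun j => if j is 0 then GP else xi_projective xi) A.
Proof.
elim: n A => // n IH A /= [K1 [G0 [k1 [g0 [h0 [gG0 x0 /IH rK]]]]]].
case: n rK {IH} => [|n] /= [K2 [G1 [k2 [g1 [h1 [gG1 x1 rK2]]]]]].
all: have [L [P [F [pP gF [a [b [c xa]]] [a' [b' [c' xa']]]]]]] :=
  gp_step_projective xi_proper xi_enough x1 x0 gG1 gG0.
all: exists L, F, a', b', c'; split=> //.
all: by exists K2, P, a, b, c.
Qed.

(** A single exchange of the first two terms, hence the length at least 1. *)
Lemma resolution_projective_head n A :
  resolution xi n.+1 (fun _ => GP) A ->
  resolution xi n.+1 (fun j => if j is 0 then xi_projective xi else GP) A.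
Proof.
move=> /= [K1 [G0 [k1 [g0 [h0 [gG0 x0]]]]]].
case: n => [|n] /= [K2 [G1 [k2 [g1 [h1 [gG1 x1 rK2]]]]]].
all: have [X [P [F [pP gF [a [b [c xa]]] [a' [b' [c' xa']]]]]]] :=
  projective_step_gp xi_proper xi_enough x1 x0 gG1 gG0.
all: exists X, P, a', b', c'; split=> //.
all: by exists K2, F, a, b, c.
Qed.

(** Making the head projective leaves an all-Gorenstein tail, so this is repeated [i] times before
    the remaining tail is made projective except for its head. *)
Lemma resolution_gp_at n i A : i <= n ->
  resolution xi n (fun _ => GP) A ->
  resolution xi n (fun j => if j == i then GP else xi_projective xi) A.
Proof.
elim: i n A => [|i IH] n A.
  by move=> _ /resolution_gp_head; apply: resolution_mono => -[].
case: n => // n lein /resolution_projective_head.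
move=> /= [K [P [f [g [h [pP xf rK]]]]]].
by exists K, P, f, g, h; split=> //; apply: IH rK.
Qed.

End GorensteinResolutions.

(** For [n = 0] condition (3) says that [A] itself is projective, while (1) only makes it Gorenstein
    projective; hence the restriction to [0 < n] in the last implication. *)
Theorem proposition3p8 (T : triangulated_category) (xi : triangle_class T)
    (xi_proper : proper_class xi) (xi_enough : enough_projectives xi)
    (A : T) (n : nat) :
  let cond1 := gpd_le xi A n in
  let cond2 := forall i : nat, i <= n ->
    exists X : augmented_seq A,
      [/\ xi_exact xi n X,
          forall j : nat, j <= n -> j != i -> xi_projective xi (seq_obj X j) &
          gorenstein_projective xi (seq_obj X i)] in
  let cond3 := forall i : nat, i <= n ->
    exists X : augmented_seq A,
      [/\ xi_exact xi n X,
          forall j : nat, j <= n -> j != i ->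
            gorenstein_projective xi (seq_obj X j) &
          xi_projective xi (seq_obj X i)] in
  [/\ cond1 <-> cond2, cond3 -> cond1 & 0 < n -> cond1 -> cond3].
Proof.
move=> cond1 cond2 cond3.
have proj_gp P : xi_projective xi P -> gorenstein_projective xi P.
  exact: projective_gp.
have cond1_res : cond1 -> resolution xi n (fun _ => gorenstein_projective xi) A.
  by move=> [X [eX gX]]; apply: resolution_of_exact eX gX.
split; first split.
- move=> /cond1_res rA i lein.
  have [X [eX QX]] := exact_of_resolution
    (resolution_gp_at xi_proper xi_enough lein rA).
  exists X; split=> // [j jn ji|]; last by have := QX i lein; rewrite eqxx.
  by have := QX j jn; rewrite (negPf ji).
- move=> /(_ 0 (leq0n n)) [X [eX pX gX]]; exists X; split=> // j jn.
  by have [->|j0] := eqVneq j 0; last exact/proj_gp/pX.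
- move=> /(_ 0 (leq0n n)) [X [eX gX pX]]; exists X; split=> // j jn.
  by have [->|j0] := eqVneq j 0; [exact: proj_gp|exact: gX].
- move=> n0 /cond1_res rA [|i] lein.
    case: n n0 rA {cond1 cond2 cond3 cond1_res lein} => // m _ rA.
    have [X [eX QX]] := exact_of_resolution
      (resolution_projective_head xi_proper xi_enough rA).
    by exists X; split=> // [[] // j jm _|]; [apply: (QX j.+1)|apply: (QX 0)].
  (* For a positive index, a sequence with all terms projective except the one at 0 already serves,
     projectives being Gorenstein projective. *)
  have [X [eX QX]] := exact_of_resolution
    (resolution_gp_head xi_proper xi_enough rA).
  exists X; split=> // [[|j] jn _|]; [exact: (QX 0)| |exact: (QX i.+1)].
  exact/proj_gp/(QX j.+1).
Qed.
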